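(* As formal power series in $q$: \begin{align*} U(\kappa) &= 5 \xi^3 - 20 \xi^4 + 16 \xi^5,\\ U(\xi) &= 5 \xi - 4 \xi^2,\\ U(\kappa^2) &= -\xi^5 + 50 \xi^6 - 400 \xi^7 + 1120 \xi^8 - 1280 \xi^9 + 512 \xi^{10},\\ U(\kappa\xi) &= 3 \xi^3 - 18 \xi^4 + 16 \xi^5,\\ U(\xi^2) &= -9 \xi + 58 \xi^2 - 80 \xi^3 + 32 \xi^4. \end{align*}
   Context: Let $E(q)=\prod_{m\ge1}(1-q^m)$. Define $$\gamma(q)=\frac{E(q)^5E(q^2)^5E(q^6)^5}{E(q^3)^{15}},\qquad \xi=\xi(q)=\frac{E(q^2)^5E(q^6)}{E(q)E(q^3)^5},\qquad \kappa=\kappa(q)=\frac{\gamma(q^2)^2}{\gamma(q)}.$$ $U$ is the operator on power series given by $U\left(\sum_n a_nq^n\right)=\sum_n a_{2n}q^n$. *)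

(* Defs.v *)
From mathcomp Require Import all_boot all_order all_algebra.
Set Implicit Arguments. Unset Strict Implicit. Unset Printing Implicit Defensive.
Import Order.TTheory GRing.Theory Num.Theory.
Local Open Scope ring_scope.

Definition fps := nat -> rat.

Definition fconst (c : rat) : fps := fun n => if n == 0%N then c else 0.
Definition fone : fps := fconst 1.
Definition fadd (f g : fps) : fps := fun n => f n + g n.
Definition fscale (c : rat) (f : fps) : fps := fun n => c * f n.
Definition fmul (f g : fps) : fps :=
  fun n => \sum_(i < n.+1) f i * g (n - i)%N.
Definition fexp (f : fps) (k : nat) : fps := iter k (fmul f) fone.

(* multiplicative inverse of a series with nonzero constant term:
   g 0 = (f 0)^-1 and, for n >= 1, g n = -(f 0)^-1 * sum_{j=1}^n f j g (n-j) *)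
Fixpoint inv_seq (f : fps) (n : nat) : seq rat :=
  match n with
  | 0 => [:: (f 0%N)^-1]
  | n'.+1 => let s := inv_seq f n' in
      rcons s (- (f 0%N)^-1 * \sum_(i < n'.+1) f i.+1 * nth 0 s (n' - i)%N)
  end.
Definition finv (f : fps) : fps := fun n => nth 0 (inv_seq f n) n.

Definition dil (k : nat) (f : fps) : fps :=
  fun n => if (k %| n)%N then f (n %/ k)%N else 0.

Definition U (f : fps) : fps := fun n => f (2 * n)%N.

(* E(q) = prod_{m>=1} (1 - q^m); its n-th coefficient is the n-th
   coefficient of the finite product over 1 <= m <= n *)
Definition E : fps :=
  fun n => (\prod_(1 <= m < n.+1) (1 - 'X^m) : {poly rat})`_n.


Definition gam : fps :=
  fmul (fmul (fexp E 5) (fexp (dil 2 E) 5))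
       (fmul (fexp (dil 6 E) 5) (finv (fexp (dil 3 E) 15))).

Definition xi : fps :=
  fmul (fmul (fexp (dil 2 E) 5) (dil 6 E))
       (finv (fmul E (fexp (dil 3 E) 5))).

Definition kappa : fps := fmul (fexp (dil 2 gam) 2) (finv gam).

Definition fpoly (f : fps) (cs : seq (int * nat)) : fps :=
  foldr (fun ck acc => fadd (fscale ck.1%:~R (fexp f ck.2)) acc) (fconst 0) cs.

(* Main.v *)
(* Let [t = q E(q^2)^2 E(q^12)^4 / (E(q^4)^4 E(q^6)^2)], which is odd in [q].  The
   eta quotients [etaP] and [etaQ] are [1 + t] and [1 + 3t], and a comparison
   of exponents of the [E(q^k)] then gives
     [kappa = (1-t)^-5],  [xi = (1+3t)/(1+t)^2],  [xi(q^2) = 1/(1-t^2)].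
   As [U f (q^2)] is the even part of [f], and [q := -q] is [t := -t], each claim
   becomes an identity between rational functions of [t].

   To identify [p = etaP] and [r = etaQ], write [f'] for [f(-q)].  Product
   manipulations express [p p'], [r r'] and [t^2] by the same series at [q^2], and
   two theta function identities give [p - p' = 2t] and [p' r - p r' = 4t].  The
   theta identities come from the Jacobi triple product by changes of variables in
   a rank two lattice.  With [p = n(q^2) + t], these five relations say that the
   first nonzero coefficient of [n - 1] vanishes: the product relations exclude an
   even index, the second theta identity an odd one.  Hence [n = 1]. *)
From HB Require Import structures.
From mathcomp Require Import all_boot all_order all_algebra.
From mathcomp Require Import boolp classical_sets functions cardinality fsbigop.
From mathcomp Require Import ring lra zify.
Require Import Defs.
Set Implicit Arguments. Unset Strict Implicit. Unset Printing Implicit Defensive.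
Import GRing.Theory Num.Theory.
Local Open Scope ring_scope.

(** * Formal power series as an integral domain *)

Lemma fpsP (f g : fps) : f =1 g <-> f = g.
Proof. by split=> [/funext|->]. Qed.

HB.instance Definition _ := gen_eqMixin fps.
HB.instance Definition _ := gen_choiceMixin fps.

Definition fopp (f : fps) : fps := fun n => - f n.

Fact faddA : associative fadd.
Proof. by move=> f g h; apply/fpsP => n; rewrite /fadd addrA. Qed.
Fact faddC : commutative fadd.
Proof. by move=> f g; apply/fpsP => n; rewrite /fadd addrC. Qed.
Fact fadd0 : left_id (fconst 0) fadd.
Proof. by move=> f; apply/fpsP => n; rewrite /fadd /fconst if_same add0r. Qed.
Fact faddN : left_inverse (fconst 0) fopp fadd.
Proof. by move=> f; apply/fpsP => n; rewrite /fadd /fopp /fconst if_same addNr. Qed.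

HB.instance Definition _ := GRing.isZmodule.Build fps faddA faddC fadd0 faddN.

Definition trunc (n : nat) (f : fps) : {poly rat} := \poly_(i < n.+1) f i.

Lemma coef_trunc n f i : (i <= n)%N -> (trunc n f)`_i = f i.
Proof. by move=> le_in; rewrite coef_poly ltnS le_in. Qed.

(** Coefficient [n] of a product involves only coefficients up to [n], so the ring laws of [fps] can
    be borrowed from truncating polynomials. *)
Lemma fmulE n (p q : {poly rat}) (f g : fps) :
  (forall i, (i <= n)%N -> p`_i = f i) -> (forall i, (i <= n)%N -> q`_i = g i) ->
  (p * q)`_n = fmul f g n.
Proof.
move=> pf qg; rewrite coefM; apply: eq_bigr => i _.
by rewrite pf -1?ltnS // qg // leq_subr.
Qed.

Lemma fmul_trunc n f g : fmul f g n = (trunc n f * trunc n g)`_n.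
Proof. by symmetry; apply: fmulE => i; apply: coef_trunc. Qed.

Lemma fmul_trunc_le n f g i :
  (i <= n)%N -> (trunc n f * trunc n g)`_i = fmul f g i.
Proof.
by move=> le_in; apply: fmulE => j le_ji; rewrite coef_trunc // (leq_trans le_ji).
Qed.

Fact fmulA : associative fmul.
Proof.
move=> f g h; apply/fpsP => n.
rewrite -(@fmulE n (trunc n f) (trunc n g * trunc n h)); first last.
- by move=> i; apply: fmul_trunc_le.
- by move=> i; apply: coef_trunc.
rewrite mulrA; apply: fmulE; last by move=> i; apply: coef_trunc.
by move=> i; apply: fmul_trunc_le.
Qed.

Fact fmulC : commutative fmul.
Proof. by move=> f g; apply/fpsP => n; rewrite !fmul_trunc mulrC. Qed.

Lemma coef_fone n i : (i <= n)%N -> (1 : {poly rat})`_i = fone i.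
Proof. by rewrite coef1 /fone /fconst; case: (i == 0%N). Qed.

Fact fmul1 : left_id fone fmul.
Proof.
move=> f; apply/fpsP => n; rewrite -(@fmulE n 1 (trunc n f)).
- by rewrite mul1r coef_trunc.
- exact: coef_fone.
- by move=> i; apply: coef_trunc.
Qed.

Fact fmulDl : left_distributive fmul fadd.
Proof.
move=> f g h; apply/fpsP => n.
by rewrite /fadd /fmul -big_split; apply: eq_bigr => i _; rewrite mulrDl.
Qed.

Fact fone_neq0 : fone != 0.
Proof.
by apply/eqP => /fpsP/(_ 0%N)/eqP; rewrite /fone /fconst /= oner_eq0.
Qed.

HB.instance Definition _ :=
  GRing.Zmodule_isComNzRing.Build fps fmulA fmulC fmul1 fmulDl fone_neq0.

Lemma fcoefD (f g : fps) n : (f + g) n = f n + g n. Proof. by []. Qed.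
Lemma fcoefN (f : fps) n : (- f) n = - f n. Proof. by []. Qed.
Lemma fcoefB (f g : fps) n : (f - g) n = f n - g n. Proof. by []. Qed.
Lemma fcoef0 n : (0 : fps) n = 0.
Proof. by rewrite /0%R /= /fconst if_same. Qed.
Lemma fcoef1 n : (1 : fps) n = (n == 0%N)%:R.
Proof. by rewrite /1%R /= /fone /fconst; case: (n == 0%N). Qed.
Lemma fcoefM (f g : fps) n : (f * g) n = \sum_(i < n.+1) f i * g (n - i)%N.
Proof. by []. Qed.
Lemma fcoefM0 (f g : fps) : (f * g) 0%N = f 0%N * g 0%N.
Proof. by rewrite fcoefM big_ord1. Qed.
Lemma fcoef_sum (I : Type) (r : seq I) (P : pred I) (F : I -> fps) n :
  (\sum_(i <- r | P i) F i) n = \sum_(i <- r | P i) F i n.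
Proof. by elim/big_ind2: _ => [|f x g y <- <-|]; rewrite ?fcoef0. Qed.

Lemma fexpE f n : fexp f n = f ^+ n.
Proof. by elim: n => [|n IHn] //; rewrite exprS -IHn. Qed.
Lemma fmul_mulr (f g : fps) : fmul f g = f * g. Proof. by []. Qed.

Lemma nth_inv_seq f m n : (n <= m)%N -> nth 0 (inv_seq f m) n = finv f n.
Proof.
have szs k : size (inv_seq f k) = k.+1.
  by elim: k => // k IHk; rewrite size_rcons IHk.
elim: m => [|m IHm]; first by rewrite leqn0 => /eqP ->.
rewrite leq_eqVlt => /predU1P[->//|]; rewrite ltnS => le_nm.
by rewrite /= nth_rcons szs ltnS le_nm IHm.
Qed.

Lemma finv0 f : finv f 0 = (f 0%N)^-1. Proof. by []. Qed.

Lemma finvS f n :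
  finv f n.+1 = - (f 0%N)^-1 * \sum_(i < n.+1) f i.+1 * finv f (n - i)%N.
Proof.
have szs k : size (inv_seq f k) = k.+1.
  by elim: k => // k IHk; rewrite size_rcons IHk.
rewrite /finv /= nth_rcons szs ltnn eqxx; congr (_ * _).
by apply: eq_bigr => i _; rewrite nth_inv_seq // leq_subr.
Qed.

Lemma finvM (f : fps) : f 0%N != 0 -> finv f * f = 1.
Proof.
move=> f0; rewrite mulrC; apply/fpsP => -[|n].
  by rewrite fcoefM0 finv0 divff // fcoef1.
rewrite fcoefM fcoef1 big_ord_recl subn0 finvS mulrA mulrN divff // mulN1r.
by apply/eqP; rewrite addrC subr_eq0; apply/eqP; apply: eq_bigr => i _.
Qed.

Definition funit : pred fps := fun f => f 0%N != 0.
(** Non-units are their own inverse, as the unit ring interface demands. *)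
Definition funitV (f : fps) : fps := if funit f then finv f else f.

Fact funitV_mul : {in funit, left_inverse 1 funitV *%R}.
Proof. by move=> f uf; rewrite /funitV ifT // finvM. Qed.
Fact funit_intro (f g : fps) : g * f = 1 -> funit f.
Proof.
move=> /fpsP/(_ 0%N); rewrite fcoefM0 fcoef1 => gf1; apply/eqP => f0.
by move/eqP: gf1; rewrite f0 mulr0 eq_sym oner_eq0.
Qed.
Fact funitV_out : {in [predC funit], funitV =1 id}.
Proof. by move=> f; rewrite inE /funitV => nuf; rewrite ifN. Qed.

HB.instance Definition _ := GRing.ComNzRing_hasMulInverse.Build fps
  funitV_mul funit_intro funitV_out.

Fact fps_integral : GRing.integral_domain_axiom fps.
Proof.
move=> f g fg0; apply: contrapT => /negP; rewrite negb_or => /andP[/eqP f0 /eqP g0].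
have nz (h : fps) : h <> 0 -> exists n, h n != 0.
  move=> h0; apply/not_existsP => hn; apply: h0; apply/fpsP => n.
  by rewrite fcoef0; apply/eqP/negPn/negP.
case: (ex_minnP (nz f f0)) => m fm min_m.
case: (ex_minnP (nz g g0)) => n gn min_n.
have /fpsP/(_ (m + n)%N)/eqP := fg0; rewrite fcoef0 fcoefM.
(* By minimality of [m] and [n], only the term of index [m] survives in coefficient [m + n]. *)
have ltm : (m < (m + n).+1)%N by rewrite ltnS leq_addr.
rewrite (bigD1 (Ordinal ltm)) //= addKn big1 ?addr0.
  by rewrite mulf_eq0 (negPf fm) (negPf gn).
move=> i; rewrite -val_eqE /= => ne_im.
have [lt_im|le_mi] := ltnP i m.
  by have [/eqP->|/min_m] := boolP (f i == 0); rewrite ?mul0r // leqNgt lt_im.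
have [/eqP->|/min_n] := boolP (g (m + n - i)%N == 0); rewrite ?mulr0 //.
by have := ltn_ord i => ? ?; exfalso; lia.
Qed.

HB.instance Definition _ := GRing.ComUnitRing_isIntegral.Build fps fps_integral.

Lemma funitE (f : fps) : (f \is a GRing.unit) = (f 0%N != 0).
Proof. by []. Qed.
Lemma finvE (f : fps) : f 0%N != 0 -> finv f = f^-1.
Proof. by move=> f0; rewrite /GRing.inv /= /funitV ifT. Qed.

(** Gives access to [field]: identities between quotients of series are proved in a field and pulled
    back by injectivity. *)
Lemma idomain_embeds_in_field (R : idomainType) :
  exists (F : fieldType) (f : {rmorphism R -> F}), injective f.
Proof.
exists {fraction R}, (@FracField.tofrac R) => x y /eqP.
by rewrite tofrac_eq => /eqP.
Qed.

(** * The indeterminate and congruences modulo its powers *)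

Definition fX : fps := fun n => (n == 1%N)%:R.

Lemma fcoefXM (f : fps) n : (fX * f) n = if n is m.+1 then f m else 0.
Proof.
case: n => [|n]; first by rewrite fcoefM0 mul0r.
rewrite fcoefM big_ord_recl mul0r add0r big_ord_recl mul1r subSS subn0.
by rewrite big1 ?addr0 // => i _; rewrite /fX mul0r.
Qed.

Lemma fcoefXnM k (f : fps) n : (fX ^+ k * f) n = if (n < k)%N then 0 else f (n - k)%N.
Proof.
elim: k n => [|k IHk] n; first by rewrite mul1r subn0.
by rewrite exprS -mulrA fcoefXM; case: n => // n; rewrite IHk.
Qed.

Lemma fcoefXn k n : (fX ^+ k) n = (n == k)%:R.
Proof.
rewrite -[fX ^+ k]mulr1 fcoefXnM fcoef1.
by case: ltngtP => [//|lt|->]; rewrite ?subnn // subn_eq0 leqNgt lt.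
Qed.

Lemma fX_neq0 : fX != 0.
Proof. by apply/eqP => /fpsP/(_ 1%N)/eqP; rewrite fcoef0 oner_eq0. Qed.

(* Congruence modulo [X^(n+1)], not [X^n]. *)
Definition modX n (f g : fps) := forall i, (i <= n)%N -> f i = g i.

Lemma modX_refl n f : modX n f f. Proof. by []. Qed.
Lemma modX_sym n f g : modX n f g -> modX n g f.
Proof. by move=> fg i le_in; rewrite fg. Qed.
Lemma modX_trans n f g h : modX n f g -> modX n g h -> modX n f h.
Proof. by move=> fg gh i le_in; rewrite fg // gh. Qed.
Lemma modX_le m n f g : (m <= n)%N -> modX n f g -> modX m f g.
Proof. by move=> le_mn fg i le_im; apply/fg/(leq_trans le_im). Qed.
Lemma modXD n f f' g g' : modX n f f' -> modX n g g' -> modX n (f + g) (f' + g').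
Proof. by move=> ff gg i le_in; rewrite !fcoefD ff ?gg. Qed.
Lemma modXB n f f' g g' : modX n f f' -> modX n g g' -> modX n (f - g) (f' - g').
Proof. by move=> ff gg i le_in; rewrite !fcoefB ff ?gg. Qed.
Lemma modXM n f f' g g' : modX n f f' -> modX n g g' -> modX n (f * g) (f' * g').
Proof.
move=> ff gg i le_in; rewrite !fcoefM; apply: eq_bigr => j _.
by rewrite ff ?gg //; have := ltn_ord j; lia.
Qed.
Lemma modX_prod1 n (I : Type) (r : seq I) (P : pred I) (F : I -> fps) :
  (forall i, P i -> modX n (F i) 1) -> modX n (\prod_(i <- r | P i) F i) 1.
Proof. by move=> F1; elim/big_ind: _ => // *; rewrite -(mulr1 1); apply: modXM. Qed.
Lemma modX_mulKl n (h f g : fps) :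
  h 0%N != 0 -> modX n (h * f) (h * g) -> modX n f g.
Proof.
move=> h0 /(modXM (@modX_refl n h^-1)).
by rewrite !mulKr.
Qed.

Lemma modX_expX n k (f : fps) : (n < k)%N -> modX n (fX ^+ k * f) 0.
Proof. by move=> lt_nk i le_in; rewrite fcoefXnM fcoef0 ifT // (leq_ltn_trans le_in). Qed.

Lemma modX_XXn n k c : (n < k)%N -> modX n (1 + c * fX ^+ k) 1.
Proof.
move=> lt_nk; rewrite -[X in modX _ _ X]addr0 [c * _]mulrC.
by apply: modXD => //; apply: modX_expX.
Qed.

(** * The substitutions [q := q^k] and [q := -q] *)

Lemma sum_dvdn (k m : nat) (F : nat -> rat) : (0 < k)%N ->
  (forall i, ~~ (k %| i)%N -> F i = 0) ->
  \sum_(i < (k * m).+1) F i = \sum_(i < m.+1) F (k * i)%N.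
Proof.
move=> k0 F0; elim: m => [|m IHm]; first by rewrite muln0 !big_ord1 muln0.
rewrite [RHS]big_ord_recr /= -IHm -!(big_mkord xpredT F).
rewrite mulnS addnC (@big_cat_nat _ _ _ (k * m).+1) //=; last by rewrite ltnS leq_addr.
(* The new block of [k] indices contains a single multiple of [k], its last element. *)
congr (_ + _); rewrite big_nat_recr /=; last by rewrite -[X in (X < _)%N]addn0 ltn_add2l.
rewrite big_nat big1 => [|i]; first by rewrite add0r [(k * m + k)%N]addnC -mulnS.
move=> /andP[lt1 lt2]; apply: F0.
apply/negP => /dvdnP[j ej]; move: lt1 lt2.
by rewrite ej -mulnSr ![(k * _)%N]mulnC !ltn_pmul2r //; lia.
Qed.

(** With the factor written [k.+1], positivity is built in and the morphism instances apply to
    numerals, as in [dil 2]. *)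
Fact dilB k : zmod_morphism (dil k.+1).
Proof. by move=> f g; apply/fpsP => n; rewrite fcoefB /dil; case: ifP; rewrite ?subr0. Qed.

Fact dilM k : monoid_morphism (dil k.+1).
Proof.
split.
  apply/fpsP => n; rewrite /dil !fcoef1; case: ifP => [/dvdnP[m ->]|].
    by rewrite mulnK // muln_eq0 orbF.
  by case: n => // n _.
move=> f g; apply/fpsP => n; rewrite fcoefM {1}/dil; case: ifP => [/dvdnP[m ->]|ndv].
  rewrite mulnK // mulnC fcoefM.
  pose F i := dil k.+1 f i * dil k.+1 g (k.+1 * m - i)%N.
  rewrite (@sum_dvdn _ _ F) // => [|i ndvi]; last by rewrite /F /dil (negPf ndvi) mul0r.
  apply: eq_bigr => i _; rewrite /F /dil dvdn_mulr // mulKn // -mulnBr.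
  by rewrite dvdn_mulr // mulKn.
rewrite big1 // => i _; rewrite /dil; case: ifP; last by rewrite mul0r.
case: ifP; last by rewrite mulr0.
move=> d1 d2; have le_in : (i <= n)%N by rewrite -ltnS.
by rewrite -(subnK le_in) dvdn_add in ndv.
Qed.

HB.instance Definition _ k := GRing.isZmodMorphism.Build fps fps (dil k.+1) (dilB k).
HB.instance Definition _ k := GRing.isMonoidMorphism.Build fps fps (dil k.+1) (dilM k).

Lemma dil_dil a b f : (0 < b)%N -> dil a (dil b f) = dil (a * b) f.
Proof.
move=> b0; apply/fpsP => n; rewrite /dil; have [/dvdnP[m ->]|nda] := boolP (a %| n)%N.
  case: (posnP a) => [->|a0]; first by rewrite !muln0 mul0n /= !divn0 dvdn0 div0n.
  by rewrite mulnK // [(m * a)%N]mulnC dvdn_pmul2l // divnMl.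
by rewrite ifN //; apply: contra nda; apply: dvdn_trans; apply: dvdn_mulr.
Qed.

Lemma dilX k n : dil k.+1 (fX ^+ n) = fX ^+ (k.+1 * n).
Proof.
apply/fpsP => i; rewrite /dil !fcoefXn; case: ifP => [/dvdnP[j ->]|ndv].
  by rewrite mulnK // mulnC eqn_pmul2l.
by case: eqP ndv => // ->; rewrite dvdn_mulr.
Qed.

Lemma dil_inj k : injective (dil k.+1).
Proof.
by move=> f g /fpsP fg; apply/fpsP => n; have := fg (k.+1 * n)%N; rewrite /dil dvdn_mulr // mulKn.
Qed.

Lemma coef_dil0 k f : (dil k f) 0%N = f 0%N.
Proof. by rewrite /dil dvdn0 div0n. Qed.

Lemma modX_dil k n f g : modX n f g -> modX n (dil k f) (dil k g).
Proof.
by move=> fg i le_in; rewrite /dil; case: ifP => // _; apply/fg/(leq_trans _ le_in)/leq_div.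
Qed.

(** The substitution [q := -q], as opposed to the additive inverse [fopp]. *)
Definition fneg (f : fps) : fps := fun n => (-1) ^+ n * f n.

Fact fnegB : zmod_morphism fneg.
Proof. by move=> f g; apply/fpsP => n; rewrite fcoefB /fneg fcoefB mulrBr. Qed.

Fact fnegM : monoid_morphism fneg.
Proof.
split; first by apply/fpsP => -[|n]; rewrite /fneg !fcoef1 ?mulr1 ?mulr0.
move=> f g; apply/fpsP => n; rewrite /fneg fcoefM mulr_sumr; apply: eq_bigr => i _.
have le_in : (i <= n)%N by rewrite -ltnS.
by rewrite mulrACA -exprD subnKC.
Qed.

HB.instance Definition _ := GRing.isZmodMorphism.Build fps fps fneg fnegB.
HB.instance Definition _ := GRing.isMonoidMorphism.Build fps fps fneg fnegM.

Lemma fneg_X : fneg fX = - fX.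
Proof.
apply/fpsP => n; rewrite /fneg fcoefN /fX.
by case: eqP => [->|]; rewrite ?mulr1 ?mulr0 ?oppr0.
Qed.

Lemma fneg_dil k f : ~~ odd k -> fneg (dil k f) = dil k f.
Proof.
move=> ek; apply/fpsP => n; rewrite /fneg /dil; case: ifP; rewrite ?mulr0 // => /dvdnP[m ->].
by rewrite -signr_odd oddM (negPf ek) andbF mul1r.
Qed.

Lemma fneg_dil_odd k f : odd k -> fneg (dil k f) = dil k (fneg f).
Proof.
move=> ok; apply/fpsP => n; rewrite /fneg /dil; case: ifP; rewrite ?mulr0 // => /dvdnP[m ->].
have k0 : (0 < k)%N by case: k ok.
by rewrite mulnK // -signr_odd oddM ok andbT signr_odd.
Qed.

Lemma modX_fneg n f g : modX n f g -> modX n (fneg f) (fneg g).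
Proof. by move=> fg i le_in; rewrite /fneg fg. Qed.

(** Each odd coefficient of a series invariant under [q := -q] equals its own negative. *)
Lemma dil_U f : fneg f = f -> dil 2 (U f) = f.
Proof.
move=> /fpsP ef; apply/fpsP => n; rewrite /dil /U; case: ifP => [/dvdnP[m ->]|nd].
  by rewrite mulnK // mulnC.
have /eqP := ef n; rewrite /fneg -signr_odd -[odd n]negbK -dvdn2 nd mulN1r eq_sym -addr_eq0.
by rewrite -mulr2n mulrn_eq0 => /eqP.
Qed.

(** * Infinite products *)

(* The factors of an infinite product are numbered from [0]: [u m] stands for
   the factor of index [m + 1], which is [1] modulo [X^(m+1)]. *)
Definition admissible (u : nat -> fps) := forall m, modX m (u m) 1.
Definition iprod (u : nat -> fps) : fps := fun n => (\prod_(m < n) u m) n.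

Lemma modX_prod_admissible (u : nat -> fps) n N : admissible u -> (n <= N)%N ->
  modX n (\prod_(m < N) u m) (\prod_(m < n) u m).
Proof.
move=> au /subnKC <-; rewrite big_split_ord /= -[X in modX _ _ X]mulr1.
apply: modXM => //; apply: modX_prod1 => i _; apply: modX_le (au _); exact: leq_addr.
Qed.

Lemma modX_iprod u N : admissible u -> modX N (iprod u) (\prod_(m < N) u m).
Proof. by move=> au n le_nN; rewrite /iprod (modX_prod_admissible au le_nN). Qed.

(** Reduces manipulations of infinite products to finite ones; the freedom in [N] allows a
    convenient cut-off. *)
Lemma iprod_unique (u : nat -> fps) f : (forall n, exists2 N, (n <= N)%N & modX n f (\prod_(m < N) u m)) ->
  admissible u -> f = iprod u.
Proof.
move=> fu au; apply/fpsP => n; have [N le_nN /(_ n (leqnn n)) ->] := fu n.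
by rewrite (modX_prod_admissible au le_nN).
Qed.

Lemma eq_iprod (u v : nat -> fps) : u =1 v -> iprod u = iprod v.
Proof. by move=> /funext ->. Qed.

Lemma admissibleM (u v : nat -> fps) : admissible u -> admissible v -> admissible (fun m => u m * v m).
Proof. by move=> au av m; rewrite -(mulr1 1); apply: modXM. Qed.

Lemma iprodM (u v : nat -> fps) : admissible u -> admissible v -> iprod (fun m => u m * v m) = iprod u * iprod v.
Proof.
move=> au av; symmetry; apply: iprod_unique; last exact: admissibleM.
move=> n; exists n => //; rewrite big_split /=; apply: modXM; exact: modX_iprod.
Qed.

(** The first hypothesis is [q]-adic continuity, by which [phi] passes from partial products to the
    limit. *)
Lemma iprod_morph (phi : {rmorphism fps -> fps}) (u : nat -> fps) :
  (forall n f g, modX n f g -> modX n (phi f) (phi g)) -> admissible u ->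
  phi (iprod u) = iprod (fun m => phi (u m)).
Proof.
move=> mphi au; apply: iprod_unique => [n|m]; last by rewrite -(rmorph1 phi); apply: mphi.
by exists n => //; rewrite -rmorph_prod; apply/mphi/modX_iprod.
Qed.

Definition regroup k (u : nat -> fps) m := \prod_(j < k.+1) u (k.+1 * m + j)%N.

Lemma admissible_regroup k u : admissible u -> admissible (regroup k u).
Proof.
move=> au m; apply: modX_prod1 => j _; apply: modX_le (au _).
by rewrite mulSn -addnA leq_addr.
Qed.

Lemma iprod_regroup k u : admissible u -> iprod u = iprod (regroup k u).
Proof.
move=> au; apply: iprod_unique; last exact: admissible_regroup.
move=> n; exists n => //.
have -> : \prod_(m < n) regroup k u m = \prod_(m < k.+1 * n) u m.
  elim: n => [|n IHn]; first by rewrite muln0 !big_ord0.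
  by rewrite big_ord_recr /= IHn mulnSr [RHS]big_split_ord /regroup.
apply: (modX_trans (modX_iprod au)); apply: modX_sym; apply: modX_prod_admissible => //.
by rewrite leq_pmull.
Qed.

(** * Products over arithmetic progressions and the series [E(q^k)] *)

Definition fac (c : fps) a b m : fps := 1 + c * fX ^+ (a * m + b).
(* The product of [1 + c q^n] over all [n >= b] with [n = b mod a]. *)
Definition qprod c a b := iprod (fac c a b).

Lemma admissible_fac c a b : (0 < a)%N -> (0 < b)%N -> admissible (fac c a b).
Proof. by move=> a0 b0 m; apply: modX_XXn; nia. Qed.

Lemma iprod_prod n (v : nat -> nat -> fps) : (forall i, admissible (v i)) ->
  iprod (fun m => \prod_(i < n) v i m) = \prod_(i < n) iprod (v i).
Proof.
move=> av; elim: n => [|n IHn].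
  rewrite big_ord0; apply/fpsP => n.
  by rewrite /iprod big1 // => i _; rewrite big_ord0.
rewrite big_ord_recr /= -IHn -iprodM //.
  by apply: eq_iprod => m; rewrite big_ord_recr.
by move=> m; apply: modX_prod1 => i _; apply: av.
Qed.

(** The factors are sorted by the residue of their index modulo [k.+1]. *)
Lemma qprod_split k c a b : (0 < a)%N -> (0 < b)%N ->
  qprod c a b = \prod_(i < k.+1) qprod c (k.+1 * a) (a * i + b).
Proof.
move=> a0 b0; rewrite /qprod (@iprod_regroup k); last exact: admissible_fac.
have -> : regroup k (fac c a b) =
    fun m => \prod_(i < k.+1) fac c (k.+1 * a) (a * i + b) m.
  apply/funext => m; apply: eq_bigr => i _; congr (1 + c * fX ^+ _); nia.
by rewrite (@iprod_prod _ (fun i => fac c (k.+1 * a) (a * i + b))) // => i; apply: admissible_fac; lia.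
Qed.

(** Factor by factor, [(1 + x) (1 - x) = 1 - x^2]. *)
Lemma qprod_conj a b : (0 < a)%N -> (0 < b)%N ->
  qprod 1 a b * qprod (-1) a b = qprod (-1) (2 * a) (2 * b).
Proof.
move=> a0 b0; rewrite -iprodM; try exact: admissible_fac.
apply: eq_iprod => m; rewrite /fac.
have -> : (2 * a * m + 2 * b = (a * m + b) * 2)%N by lia.
by rewrite [in RHS]exprM; ring.
Qed.

(** The even step [2 * a] gives all exponents the parity of [b], hence a uniform sign. *)
Lemma qprod_neg c a b : (0 < a)%N -> (0 < b)%N -> fneg c = c ->
  fneg (qprod c (2 * a) b) = qprod ((-1) ^+ b * c) (2 * a) b.
Proof.
move=> a0 b0 ec; rewrite /qprod (iprod_morph (phi := fneg)).
- apply: eq_iprod => m; rewrite /fac rmorphD rmorph1 rmorphM rmorphXn /= ec fneg_X.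
  rewrite -mulnA [in LHS]exprD [in RHS]exprD [in LHS]exprM [in RHS]exprM sqrrN [(- fX) ^+ b]exprNn.
  by move: ((-1) ^+ b) => s; ring.
- exact: modX_fneg.
- by apply: admissible_fac => //; rewrite muln_gt0.
Qed.

Lemma qprod_dil k c a b : (0 < a)%N -> (0 < b)%N -> dil k.+1 c = c ->
  dil k.+1 (qprod c a b) = qprod c (k.+1 * a) (k.+1 * b).
Proof.
move=> a0 b0 ec; rewrite /qprod (iprod_morph (phi := dil k.+1)).
- apply: eq_iprod => m; rewrite /fac rmorphD rmorph1 rmorphM /= dilX ec.
  by rewrite mulnDr mulnA.
- by move=> n f g; apply: modX_dil.
- exact: admissible_fac.
Qed.

Lemma E_qprod : E = qprod (-1) 1 1.
Proof.
apply/fpsP => n; rewrite /E /qprod /iprod big_add1 big_mkord.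
pose same (p : {poly rat}) (f : fps) := forall i, p`_i = f i.
suff: same (\prod_(i < n) (1 - 'X^(i.+1))) (\prod_(m < n) fac (-1) 1 1 m).
  exact.
elim/big_ind2: _ => [i|p f q g pf qg i|i _ j].
- by rewrite coef1 fcoef1.
- exact: fmulE.
by rewrite /fac mul1n addn1 mulN1r fcoefB fcoef1 fcoefXn coefB coef1 coefXn.
Qed.

(** The Dedekind eta function at [q^k], without its factor [q^(k/24)]. *)
Definition eta k := dil k E.

Lemma etaE k : eta k.+1 = qprod (-1) k.+1 k.+1.
Proof. by rewrite /eta E_qprod qprod_dil ?muln1 // rmorphN rmorph1. Qed.

(** * Gaussian binomial coefficients *)

(** Pascal's rule defines the Gaussian binomials without division, over any commutative ring. *)
Fixpoint gbin (R : comNzRingType) (Q : R) (m j : nat) : R :=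
  match m, j with
  | _, 0 => 1
  | 0, _.+1 => 0
  | m.+1, j.+1 => gbin Q m j.+1 + Q ^+ (m - j) * gbin Q m j
  end.

(** The Pochhammer symbol [(Q; Q)_m]. *)
Definition qfact (R : comNzRingType) (Q : R) m : R := \prod_(i < m) (1 - Q ^+ i.+1).

Lemma gbin_small (R : comNzRingType) (Q : R) m j : (m < j)%N -> gbin Q m j = 0.
Proof.
elim: m j => [|m IHm] [|j] //= lt_mj.
by rewrite !IHm ?mulr0 ?addr0 // ltnW.
Qed.

Lemma gbinm0 (R : comNzRingType) (Q : R) m : gbin Q m 0 = 1. Proof. by case: m. Qed.

(** The homogeneous form in [y] and [z] admits [y = Q^n], which avoids negative powers of [q] in the
    triple product. *)
Lemma q_binomial (R : comNzRingType) (Q y z : R) m :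
  \prod_(i < m) (y + z * Q ^+ i) =
  \sum_(j < m.+1) gbin Q m j * Q ^+ 'C(j, 2) * z ^+ j * y ^+ (m - j).
Proof.
elim: m => [|m IHm]; first by rewrite big_ord0 big_ord1 !mulr1.
rewrite big_ord_recr /= IHm mulrDr !mulr_suml.
rewrite [X in X + _]big_ord_recl [RHS]big_ord_recl /= -addrA.
congr (_ + _).
  by rewrite !gbinm0 !subn0 -mulrA -exprSr.
(* The reindexed first sum gains a last term, zero by [gbin_small], so that both sums have the same
   range. *)
pose F j := gbin Q m j.+1 * Q ^+ 'C(j.+1, 2) * z ^+ j.+1 * y ^+ (m - j).
have -> : \sum_(i < m) gbin Q m (bump 0 i) * Q ^+ 'C(bump 0 i, 2) *
    z ^+ bump 0 i * y ^+ (m - bump 0 i) * y = \sum_(i < m.+1) F i.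
  rewrite [RHS]big_ord_recr /= {2}/F gbin_small // !mul0r addr0.
  apply: eq_bigr => i _; rewrite /bump add1n /F -mulrA -exprSr.
  by rewrite subnSK.
rewrite -big_split; apply: eq_bigr => i _; rewrite /bump add1n /F subSS /=.
have le_im : (i <= m)%N by rewrite -ltnS.
rewrite !mulrDl; congr (_ + _); rewrite binS bin1 exprS.
have -> : Q ^+ m = Q ^+ (m - i) * Q ^+ i by rewrite -exprD subnK.
rewrite exprD; ring.
Qed.

Lemma gbin_qfact (R : comNzRingType) (Q : R) m j : (j <= m)%N ->
  gbin Q m j * qfact Q j * qfact Q (m - j) = qfact Q m.
Proof.
have qfS n : qfact Q n.+1 = qfact Q n * (1 - Q ^+ n.+1) by rewrite /qfact big_ord_recr.
have qf0 : qfact Q 0 = 1 by rewrite /qfact big_ord0.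
elim: m j => [|m IHm] [|j] //= le_jm; try by rewrite qf0 !mul1r.
rewrite subSS; move: (le_jm); rewrite ltnS leq_eqVlt => /predU1P[->|lt_jm].
  rewrite gbin_small // subnn add0r mul1r qf0 mulr1 !qfS.
  by rewrite mulrA; congr (_ * _); have := IHm m (leqnn m); rewrite subnn qf0 mulr1.
have eqQ : Q ^+ m.+1 = Q ^+ (m - j) * Q ^+ j.+1 by rewrite -exprD; congr (_ ^+ _); lia.
have [k ek] : exists k, (m - j)%N = k.+1 by exists (m - j).-1; lia.
have IH1 := IHm j.+1 lt_jm; have IH2 := IHm j (ltnW lt_jm).
have eqk : (m - j.+1)%N = k by lia.
rewrite eqk qfS in IH1; rewrite ek qfS in IH2; rewrite [qfact Q m.+1]qfS eqQ ek !qfS.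
(* Since [1 - Q^(m+1) = (1 - Q^(k+1)) + Q^(k+1) (1 - Q^(j+1))], each term of Pascal's rule meets one
   induction hypothesis. *)
transitivity (gbin Q m j.+1 * (qfact Q j * (1 - Q ^+ j.+1)) * qfact Q k * (1 - Q ^+ k.+1)
  + Q ^+ k.+1 * (1 - Q ^+ j.+1) * (gbin Q m j * qfact Q j * (qfact Q k * (1 - Q ^+ k.+1)))).
  ring.
by rewrite IH1 IH2; ring.
Qed.

(** * Generating series over arbitrary index sets *)

(* [Th e] is the sum of [q^(e i)] over all [i]; it is meaningful only when each
   exponent is attained finitely often, since a big operator with infinite
   support is [0]. *)
Definition Th (I : choiceType) (e : I -> nat) : fps :=
  fun n => \sum_(i \in [set: I]) ((e i == n)%:R : rat).

(** Bounding [e i] by [n], instead of fixing it, provides one list that serves all coefficients up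
    to [n] of a product. *)
Definition finite_fibers (I : choiceType) (e : I -> nat) :=
  forall n, exists2 r : seq I, uniq r & forall i, (e i <= n)%N -> i \in r.

Lemma Th_seq (I : choiceType) (e : I -> nat) n (r : seq I) : uniq r ->
  (forall i, e i = n -> i \in r) -> Th e n = \sum_(i <- r) (e i == n)%:R.
Proof.
move=> ur rP; rewrite /Th (@fsbigE _ _ _ _ _ r) //.
  by apply: eq_bigl => i; rewrite in_setT.
by move=> i _ /negP nir; case: eqP => // /rP.
Qed.

Lemma eq_Th (I : choiceType) (e f : I -> nat) : e =1 f -> Th e = Th f.
Proof. by move=> /funext ->. Qed.

Lemma Th_bij (I J : choiceType) (h : I -> J) (e : J -> nat) : bijective h ->
  Th e = Th (e \o h).
Proof. by move=> bh; apply/fpsP => n; rewrite /Th (reindex_fsbigT h _ bh). Qed.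

Lemma finite_fibers_bij (I J : choiceType) (h : I -> J) (e : J -> nat) :
  bijective h -> finite_fibers e -> finite_fibers (e \o h).
Proof.
move=> [g hK gK] pe n; have [r ur rP] := pe n; exists (map g r).
  by rewrite map_inj_uniq //; apply: can_inj gK.
by move=> i /rP hi; rewrite -(hK i) map_f.
Qed.

Lemma finite_fibers_add (I J : choiceType) (e : I -> nat) (f : J -> nat) :
  finite_fibers e -> finite_fibers f -> finite_fibers (fun p : I * J => e p.1 + f p.2)%N.
Proof.
move=> pe pf n; have [r ur rP] := pe n; have [s us sP] := pf n.
exists (allpairs pair r s); first by apply: allpairs_uniq => // -[? ?] [? ?] _ _.
by case=> i j /= le_n; apply: allpairs_f; [apply: rP | apply: sP]; lia.
Qed.

Lemma Th_mul (I J : choiceType) (e : I -> nat) (f : J -> nat) :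
  finite_fibers e -> finite_fibers f -> Th e * Th f = Th (fun p : I * J => e p.1 + f p.2)%N.
Proof.
move=> pe pf; apply/fpsP => n; rewrite fcoefM.
have [r ur rP] := pe n; have [s us sP] := pf n.
have -> : \sum_(k < n.+1) Th e k * Th f (n - k)%N =
    \sum_(k < n.+1) \sum_(i <- r) \sum_(j <- s)
      ((e i == k) && (f j == n - k)%N)%:R.
  apply: eq_bigr => k _; have le_kn : (k <= n)%N by rewrite -ltnS.
  rewrite (@Th_seq _ _ _ r) // => [|i ei]; last by apply: rP; rewrite ei.
  rewrite (@Th_seq _ _ _ s) // => [|j fj]; last by apply: sP; rewrite fj leq_subr.
  rewrite mulr_suml; apply: eq_bigr => i _; rewrite mulr_sumr; apply: eq_bigr => j _.
  by rewrite -natrM mulnb.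
rewrite (@Th_seq _ _ _ (allpairs pair r s)); first last.
- by case=> i j /= eij; apply: allpairs_f; [apply: rP | apply: sP]; lia.
- by apply: allpairs_uniq => // -[? ?] [? ?] _ _.
rewrite big_allpairs exchange_big; apply: eq_bigr => i _ /=.
rewrite exchange_big; apply: eq_bigr => j _ /=.
(* For fixed [i] and [j] only [k = e i] can contribute, and it is in range when [e i <= n]. *)
have [le_en|lt_ne] := leqP (e i) n.
  rewrite (bigD1 (Ordinal (le_en : (e i < n.+1)%N))) //= eqxx big1 => [|k nk].
    by rewrite addr0; congr (_%:R); lia.
  by case: eqP => // ek; case/eqP: nk; apply: val_inj.
rewrite big1 => [|k _]; first by case: eqP => //; lia.
by case: eqP => //= ek; have := ltn_ord k; lia.
Qed.

(** Serves to cut a lattice into two cosets, each with its own coordinates. *)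
Lemma Th_split (I J K : choiceType) (h : I + J -> K) (e : K -> nat) :
  bijective h -> finite_fibers e -> Th e = Th (e \o h \o inl) + Th (e \o h \o inr).
Proof.
move=> bh pe; have pf := finite_fibers_bij bh pe; rewrite (Th_bij _ bh).
move: (e \o h) pf => f pf; apply/fpsP => n; rewrite fcoefD.
have [r ur rP] := pf n.
pose rl := pmap (fun x : I + J => if x is inl i then Some i else None) r.
pose rr := pmap (fun x : I + J => if x is inr j then Some j else None) r.
have memrl i : (i \in rl) = (inl i \in r).
  by rewrite /rl; elim: r {ur rP rl rr} => //= -[a|b] r IHr; rewrite ?inE IHr.
have memrr j : (j \in rr) = (inr j \in r).
  by rewrite /rr; elim: r {ur rP rl rr memrl} => //= -[a|b] r IHr; rewrite ?inE IHr.
have url : uniq rl.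
  by apply: (pmap_uniq (g := inl)) => // -[].
have urr : uniq rr.
  by apply: (pmap_uniq (g := inr)) => // -[].
rewrite (Th_seq ur) => [|i ei]; last by apply: rP; rewrite ei.
rewrite (Th_seq url) => [|i ei]; last by rewrite memrl; apply: rP; rewrite -ei.
rewrite (Th_seq urr) => [|i ei]; last by rewrite memrr; apply: rP; rewrite -ei.
rewrite /rl /rr; elim: r {ur rP rl rr memrl memrr url urr} => [|[a|b] r IHr].
- by rewrite !big_nil addr0.
- by rewrite /= !big_cons IHr addrA.
- by rewrite /= !big_cons IHr addrCA.
Qed.

Lemma Th_shift (I : choiceType) (e : I -> nat) k :
  Th (fun i => e i + k)%N = fX ^+ k * Th e.
Proof.
apply/fpsP => n; rewrite fcoefXnM /Th; case: ltnP => [lt_nk|le_kn].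
  by rewrite fsbig1 // => i _; case: eqP => //; lia.
by apply: eq_fsbigr => i _; congr (_%:R); lia.
Qed.

Lemma Th_dil (I : choiceType) (e : I -> nat) k :
  dil k.+1 (Th e) = Th (fun i => k.+1 * e i)%N.
Proof.
apply/fpsP => n; rewrite /dil /Th; case: ifP => [/dvdnP[m ->]|nd].
  by rewrite mulnK //; apply: eq_fsbigr => i _; rewrite mulnC eqn_pmul2r.
rewrite fsbig1 // => i _; case: eqP => // en.
by rewrite -en dvdn_mulr in nd.
Qed.

Lemma Th_neg (I : choiceType) (e : I -> nat) b :
  (forall i, odd (e i) = b) -> fneg (Th e) = (-1) ^+ b * Th e.
Proof.
move=> eb; apply/fpsP => n.
have -> : ((-1) ^+ b * Th e) n = (-1) ^+ b * Th e n.
  by case: b {eb}; rewrite !(mul1r, mulN1r).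
rewrite /fneg -signr_odd; have [<-//|nb] := eqVneq (odd n) b.
rewrite /Th fsbig1 ?mulr0 // => i _; case: eqP => // en.
by rewrite -en eb eqxx in nb.
Qed.

(** * Two-parameter theta series and the Jacobi triple product *)

(* [k(k+1)/2]; the branches agree because [Negz n] is [-(n+1)]. *)
Definition tri (k : int) : nat :=
  match k with Posz n => 'C(n.+1, 2) | Negz n => 'C(n.+1, 2) end.

Lemma triE k : (2 * tri k)%N%:Z = k * (k + 1).
Proof.
have tE n : (2 * 'C(n.+1, 2) = n.+1 * n)%N by rewrite -mul_bin_diag bin1.
by case: k => n; rewrite /tri tE; lia.
Qed.

(** The exponents of Ramanujan's theta function [f(q^a, q^b)]; triangular numbers keep them in
    [nat]. *)
Definition texp (a b : nat) (k : int) : nat := (a * tri k + b * tri (k - 1))%N.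

(** Doubling clears the halves, so that comparing exponents becomes polynomial arithmetic over the
    integers. *)
Lemma texpE a b k : (2 * texp a b k)%N%:Z = a%:Z * (k * (k + 1)) + b%:Z * (k * (k - 1)).
Proof.
have := triE k; have := triE (k - 1); rewrite /texp => e1 e2.
have -> : (2 * (a * tri k + b * tri (k - 1)))%N%:Z =
  a%:Z * (2 * tri k)%N%:Z + b%:Z * (2 * tri (k - 1))%N%:Z by lia.
by rewrite e1 e2; ring.
Qed.

(** Both triangular numbers are at least [|k| - 1], and one of them has a positive coefficient. *)
Lemma texp_ge a b k : (0 < a + b)%N -> (`|k| <= (texp a b k).+1)%N.
Proof.
move=> ab0; have := triE k; have := triE (k - 1); rewrite /texp => e1 e2.
have t1 : (`|k| <= (tri k).+1)%N by nia.
have t2 : (`|k| <= (tri (k - 1)).+1)%N by nia.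
by have [a0|a0] := posnP a; nia.
Qed.

Lemma finite_fibers_texp a b : (0 < a + b)%N -> finite_fibers (texp a b).
Proof.
move=> ab0 n; exists [seq i%:Z - n.+1%:Z | i <- iota 0 (2 * n.+1).+1].
  by rewrite map_inj_uniq ?iota_uniq // => i j; lia.
move=> k le_kn; have := texp_ge k ab0 => le_k.
apply/mapP; exists (absz (k + n.+1%:Z)); last by lia.
by rewrite mem_iota; lia.
Qed.

Definition theta a b := Th (texp a b).

Lemma admissible_facs a b : (0 < a)%N -> (0 < b)%N ->
  [/\ admissible (fac 1 (a + b) a), admissible (fac 1 (a + b) b) & admissible (fac (-1) (a + b) (a + b))].
Proof. by move=> a0 b0; split; apply: admissible_fac; lia. Qed.

(** The [q]-binomial theorem with [2n] factors, [y = Q^n] and [z = q^a], after removing a power of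
    [q]. *)
Lemma finite_triple_product a b n : (0 < a)%N -> (0 < b)%N ->
  (\prod_(i < n) fac 1 (a + b) a i) * (\prod_(i < n) fac 1 (a + b) b i) =
  \sum_(j < (2 * n).+1)
    gbin (fX ^+ (a + b)) (2 * n) j * fX ^+ texp a b (j%:Z - n%:Z).
Proof.
move=> a0 b0; set Q := fX ^+ (a + b).
(* The exponent of that power: [a + (a + b) i] from each of the first [n] factors and [(a + b) n]
   from each of the others. *)
pose M := (a * n + (a + b) * ('C(n, 2) + n * n))%N.
apply: (mulfI (expf_neq0 M fX_neq0)).
have e2 : (2 * 'C(n, 2) = n * n.-1)%N by case: (n) => // m; rewrite -mul_bin_diag bin1.
(* The first [n] factors give the product for [b] in reverse order, the last [n] the product for
   [a]. *)
transitivity (\prod_(i < 2 * n) (Q ^+ n + fX ^+ a * Q ^+ i)).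
  rewrite mul2n -addnn big_split_ord /=.
  have -> : \prod_(i < n) (Q ^+ n + fX ^+ a * Q ^+ i) =
      fX ^+ (a * n + (a + b) * 'C(n, 2)) * \prod_(i < n) fac 1 (a + b) b i.
    have -> : \prod_(i < n) (Q ^+ n + fX ^+ a * Q ^+ i) =
      \prod_(i < n) (fX ^+ (a + (a + b) * i) * fac 1 (a + b) b (n - i.+1)%N).
      apply: eq_bigr => i _; rewrite /fac mul1r mulrDr mulr1 -!exprM -!exprD addrC.
      congr (_ + fX ^+ _); move: (nat_of_ord i) (ltn_ord i) => l lt_ln.
      have [k ek] : exists k, n = (l + k.+1)%N by exists (n - l.+1)%N; lia.
      have -> : (n - l.+1)%N = k by lia.
      by rewrite ek; nia.
    rewrite big_split /= prodrXr; congr (fX ^+ _ * _).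
      rewrite big_split /= sum_nat_const card_ord -big_distrr /=.
      by rewrite -(big_mkord xpredT id) -bin2_sum mulnC.
    by rewrite [RHS](reindex_inj rev_ord_inj).
  have -> : \prod_(i < n) (Q ^+ n + fX ^+ a * Q ^+ (n + i)) =
      fX ^+ ((a + b) * (n * n)) * \prod_(i < n) fac 1 (a + b) a i.
    have -> : fX ^+ ((a + b) * (n * n)) = \prod_(i < n) fX ^+ ((a + b) * n).
      by rewrite prodr_const card_ord -exprM mulnA.
    rewrite -big_split; apply: eq_bigr => i _ /=.
    rewrite /fac mul1r mulrDr mulr1 -!exprM -!exprD.
    by congr (_ + fX ^+ _); nia.
  by rewrite /M mulnDr addnA exprD; ring.
rewrite q_binomial mulr_sumr; apply: eq_bigr => j _.
rewrite mulrCA -!mulrA; congr (_ * _); rewrite -!exprM -!exprD; congr (fX ^+ _).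
have := texpE a b (j%:Z - n%:Z); have := ltn_ord j => lt_j.
have e3 : (2 * 'C(j, 2) = j * j.-1)%N by case: (nat_of_ord j) => // m; rewrite -mul_bin_diag bin1.
rewrite /M; move: e2 e3; move: (texp _ _ _) ('C(n, 2)) ('C(j, 2)) => t c d e2 e3 et.
have [k ek] : exists k, (2 * n)%N = (j + k)%N by exists (2 * n - j)%N; lia.
have -> : (2 * n - j)%N = k by lia.
have e2' : 2 * c%:Z = n%:Z * (n%:Z - 1) by nia.
have e3' : 2 * d%:Z = j%:Z * (j%:Z - 1) by nia.
have ek' : 2 * n%:Z = j%:Z + k%:Z by lia.
suff : 2 * (a * n + (a + b) * (c + n * n) + t)%N%:Z =
  2 * ((a + b) * d + (a * j + (a + b) * (n * k)))%N%:Z by lia.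
have ek2 : k%:Z = 2 * n%:Z - j%:Z by lia.
transitivity (2 * a%:Z * n%:Z + (a%:Z + b%:Z) * (2 * c%:Z + 2 * n%:Z * n%:Z)
  + (2 * t)%N%:Z); first by lia.
transitivity ((a%:Z + b%:Z) * (2 * d%:Z) + (2 * a%:Z * j%:Z + 2 * (a%:Z + b%:Z) * n%:Z * k%:Z));
  last by lia.
by rewrite et e2' e3' ek2; ring.
Qed.

(** The limit of the finite form, in which the Gaussian binomials tend to the inverse of [F]. *)
Lemma jacobi_triple_product a b : (0 < a)%N -> (0 < b)%N ->
  theta a b = qprod 1 (a + b) a * qprod 1 (a + b) b * qprod (-1) (a + b) (a + b).
Proof.
move=> a0 b0; have [ua ub uab] := admissible_facs a0 b0.
set F := qprod (-1) _ _; have F0 : F 0%N != 0 by rewrite /F /qprod /iprod big_ord0.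
have FP m : modX m F (qfact (fX ^+ (a + b)) m).
  apply: modX_trans (modX_iprod uab) _ => i _; congr (_ i).
  apply: eq_bigr => j _; rewrite /fac mulN1r -exprM; congr (1 - fX ^+ _); nia.
(* An exponent at most [N] forces [|j - n| <= N + 1], so with this [n] both [j] and [2n - j] are at
   least [N]. *)
apply/fpsP => N; pose n := (2 * N).+1.
have le_Nn : (N <= n)%N by lia.
rewrite [in RHS]mulrC (modXM (@modX_refl N F) (modXM
  (modX_le le_Nn (modX_iprod ua)) (modX_le le_Nn (modX_iprod ub)))) //.
rewrite finite_triple_product // mulr_sumr fcoef_sum.
rewrite /theta (@Th_seq _ _ _ [seq i%:Z - n%:Z | i <- iota 0 (2 * n).+1]); first last.
- move=> k ek; have := @texp_ge a b k; rewrite ek addn_gt0 a0 => /(_ isT) le_k.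
  by apply/mapP; exists (absz (k + n%:Z)); [rewrite mem_iota|]; lia.
- by rewrite map_inj_uniq ?iota_uniq // => i j; lia.
rewrite big_map -[iota _ _]/(index_iota 0 (2 * n).+1) big_mkord.
apply: eq_bigr => j _; set e := texp _ _ _.
rewrite mulrA mulrC fcoefXnM; case: ltnP => [lt_Ne|le_eN].
  by case: eqP lt_Ne => // ->; rewrite ltnn.
suff /(modX_le (leq_subr e N)) -> // : modX N (F * gbin (fX ^+ (a + b)) (2 * n) j) 1.
    by rewrite fcoef1; congr (_%:R); lia.
  exact: leqnn.
have := @texp_ge a b (j%:Z - n%:Z); rewrite -/e addn_gt0 a0 => /(_ isT) le_j.
have lt_j := ltn_ord j.
have le_j2 : (j <= 2 * n)%N by lia.
(* A second factor [F] lets the two copies stand for [qfact j] and [qfact (2n - j)], as in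
   [gbin_qfact]; the result [qfact (2n)] is again [F] to this order. *)
apply: (@modX_mulKl N F _ 1 F0).
have := gbin_qfact (fX ^+ (a + b)) le_j2 => gq.
have H : modX N (F * (F * gbin (fX ^+ (a + b)) (2 * n) j)) (qfact (fX ^+ (a + b)) (2 * n)).
  rewrite -gq mulrA mulrC mulrA; apply: modXM; last by apply: modX_le (FP _); lia.
  by apply: modXM => //; apply: modX_le (FP _); lia.
rewrite mulr1; apply: modX_trans H _; apply: modX_sym; apply: modX_le (FP _); lia.
Qed.

(** * Lattice changes of variables and the two theta identities *)

Lemma inj_surj_bijective (I J : Type) (h : I -> J) :
  injective h -> (forall y, exists x, h x = y) -> bijective h.
Proof.
move=> ih /choice[g hgK]; exists g => // x; exact: ih.
Qed.

Lemma int_parity (x : int) : exists t, x = 2 * t \/ x = 2 * t + 1.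
Proof. by exists (x %/ 2)%Z; lia. Qed.

(** The two cosets are the pairs of even and of odd coordinate sum. *)
Definition rot45 (x : int * int + int * int) : int * int :=
  match x with
  | inl p => (p.1 + p.2, p.1 - p.2)
  | inr p => (p.1 + p.2 + 1, p.1 - p.2)
  end.

Lemma rot45_bij : bijective rot45.
Proof.
apply: inj_surj_bijective.
  move=> [[r s]|[r s]] [[r' s']|[r' s']] /= [] *.
  - by congr (inl (_, _)); lia.
  - by exfalso; lia.
  - by exfalso; lia.
  - by congr (inr (_, _)); lia.
move=> [m n]; have [t [et|et]] := int_parity (m + n).
  by exists (inl (t, m - t)); congr (_, _) => /=; lia.
by exists (inr (t, m - t - 1)); congr (_, _) => /=; lia.
Qed.

(* Multiplication by a cube root of unity maps [(k' + l' sqrt(-3))/2], with [k']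
   and [l'] odd, into [Z[sqrt(-3)]]; here [k' = 2k + 1] and [l' = 2l + 1]. *)
Definition rot120 (x : int * int + int * int) : int * int :=
  match x with
  | inl p => (p.1 - 2 * p.2 - 1, - p.1 - 1)
  | inr p => (p.1 - 2 * p.2 - 1, p.1)
  end.

Lemma rot120_bij : bijective rot120.
Proof.
apply: inj_surj_bijective.
  move=> [[r s]|[r s]] [[r' s']|[r' s']] /= [] *.
  - by congr (inl (_, _)); lia.
  - by exfalso; lia.
  - by exfalso; lia.
  - by congr (inr (_, _)); lia.
move=> [k l]; have [t [et|et]] := int_parity (k + l).
  by exists (inl (- l - 1, - t - 1)); congr (_, _) => /=; lia.
by exists (inr (l, l - t - 1)); congr (_, _) => /=; lia.
Qed.

Lemma theta_dil k a b : dil k.+1 (theta a b) = theta (k.+1 * a) (k.+1 * b).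
Proof. by rewrite /theta Th_dil; apply: eq_Th => i; rewrite /texp; nia. Qed.

Lemma theta_mul a b c d : (0 < a + b)%N -> (0 < c + d)%N ->
  theta a b * theta c d = Th (fun p : int * int => texp a b p.1 + texp c d p.2)%N.
Proof. by move=> ab cd; apply: Th_mul; apply: finite_fibers_texp. Qed.

(** Each triangular number occurs at [2j] and at [-2j - 1]. The left side suits lattice sums; the
    right side has the positive parameters that the triple product requires. *)
Lemma theta10 : theta 1 0 = 2 * theta 3 1.
Proof.
pose h (x : int + int) : int := match x with inl j => 2 * j | inr j => - 2 * j - 1 end.
have bh : bijective h.
  apply: inj_surj_bijective.
    by move=> [i|i] [j|j] /= eij; (congr inl || congr inr || exfalso); lia.
  move=> k; have [t [et|et]] := int_parity k.
    by exists (inl t); rewrite et.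
  by exists (inr (- t - 1)); rewrite et /=; lia.
have -> : 2 * theta 3 1 = theta 3 1 + theta 3 1 by ring.
rewrite /theta (Th_split bh); last exact: finite_fibers_texp.
congr (_ + _); apply: eq_Th => j /=.
  by have := texpE 1 0 (2 * j); have := texpE 3 1 j; nia.
by have := texpE 1 0 (- 2 * j - 1); have := texpE 3 1 j; nia.
Qed.

(** The two terms are the cosets of [rot45] in the double sum for the square. *)
Lemma theta12_sqr :
  theta 1 2 ^+ 2 = dil 2 (theta 1 2) * dil 3 (theta 1 1) +
    2 * fX * theta 5 1 * dil 6 (theta 3 1).
Proof.
have -> : 2 * fX * theta 5 1 * dil 6 (theta 3 1) =
    fX * (theta 5 1 * dil 6 (theta 1 0)).
  rewrite theta10 rmorphM /= rmorph_nat; ring.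
rewrite !theta_dil expr2 !theta_mul // (Th_split rot45_bij); last first.
  by apply: finite_fibers_add; apply: finite_fibers_texp.
rewrite -[fX]expr1 -Th_shift; congr (_ + _); apply: eq_Th => -[r s] /=.
  have := texpE 1 2 (r + s); have := texpE 1 2 (r - s).
  by have := texpE (2 * 1) (2 * 2) r; have := texpE (3 * 1) (3 * 1) s; nia.
have := texpE 1 2 (r + s + 1); have := texpE 1 2 (r - s).
by have := texpE 5 1 r; have := texpE (6 * 1) (6 * 0) s; nia.
Qed.

(** Odd values of [m^2 + 3 n^2] come from odd [m + n]. The exponents on the right are
    [((2k+1)^2 + 3 (2l+1)^2) / 4], and each of the two classes of [rot120] reproduces the odd part
    once. *)
Lemma theta11_odd_part :
  theta 1 1 * dil 3 (theta 1 1) - fneg (theta 1 1 * dil 3 (theta 1 1)) =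
  4 * fX * dil 2 (theta 3 1) * dil 6 (theta 3 1).
Proof.
have -> : 4 * fX * dil 2 (theta 3 1) * dil 6 (theta 3 1) =
    fX * (dil 2 (theta 1 0) * dil 6 (theta 1 0)).
  rewrite theta10 !rmorphM /= !rmorph_nat; ring.
rewrite !theta_dil !theta_mul //.
rewrite (Th_split rot45_bij); last by apply: finite_fibers_add; apply: finite_fibers_texp.
set ev := Th _; set od := Th _.
have sq a k : texp a a k = (a * (`|k| * `|k|))%N.
  have := texpE a a k; have : (`|k| * `|k|)%N%:Z = k * k by lia.
  by nia.
have eev : fneg ev = ev.
  rewrite /ev (@Th_neg _ _ false) ?mul1r // => -[r s] /=; rewrite !sq; lia.
have eod : fneg od = - od.
  rewrite /od (@Th_neg _ _ true) ?mulN1r // => -[r s] /=; rewrite !sq; lia.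
rewrite rmorphD /= eev eod -[fX]expr1 -Th_shift (Th_split rot120_bij); last first.
  have pe : finite_fibers (fun p : int * int => texp (2 * 1) (2 * 0) p.1 + texp (6 * 1) (6 * 0) p.2)%N.
    by apply: finite_fibers_add; apply: finite_fibers_texp.
  move=> n; have [r ur rP] := pe n; exists r => // i le_i.
  by apply: rP; apply: leq_trans le_i; apply: leq_addr.
rewrite opprD opprK addrACA subrr add0r; congr (_ + _); apply: eq_Th => -[r s] /=;
rewrite !sq.
  have := texpE (2 * 1) (2 * 0) (r - 2 * s - 1); have := texpE (6 * 1) (6 * 0) (- r - 1).
  by nia.
have := texpE (2 * 1) (2 * 0) (r - 2 * s - 1); have := texpE (6 * 1) (6 * 0) r.
by nia.
Qed.

(** * Theta series and sign changes as eta quotients *)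

Lemma eta_split k a : eta a.+1 = \prod_(i < k.+1) qprod (-1) (k.+1 * a.+1) (a.+1 * i + a.+1).
Proof. by rewrite etaE (qprod_split k). Qed.

Lemma dil_eta j k : (0 < k)%N -> dil j (eta k) = eta (j * k).
Proof. exact: dil_dil. Qed.

Lemma dil1 f : dil 1 f = f.
Proof. by apply/fpsP => n; rewrite /dil dvd1n divn1. Qed.

(** As in the next three evaluations, the factors of each [eta] are sorted by residue and
    [qprod_conj] pairs [1 + x] with [1 - x]. *)
Lemma theta11_eta : theta 1 1 * (eta 1 ^+ 2 * eta 4 ^+ 2) = eta 2 ^+ 5.
Proof.
rewrite jacobi_triple_product //.
have e1 : eta 1 = qprod (-1) 2 1 * qprod (-1) 2 2.
  by rewrite (eta_split 1) !big_ord_recr big_ord0 /= mul1r.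
have e2 : eta 2 = qprod (-1) 4 2 * qprod (-1) 4 4.
  by rewrite (eta_split 1) !big_ord_recr big_ord0 /= mul1r.
have e2' : eta 2 = qprod (-1) 2 2 by rewrite etaE.
have c : qprod 1 2 1 * qprod (-1) 2 1 = qprod (-1) 4 2 by rewrite qprod_conj.
(* Three copies of [eta 2] stay whole; the other two are split modulo 4 to receive [c]. *)
have -> : eta 2 ^+ 5 = eta 2 ^+ 3 * eta 2 ^+ 2 by rewrite -exprD.
rewrite {1}e2' e2 -c e1 [eta 4]etaE; ring.
Qed.

Lemma theta31_eta : theta 3 1 * eta 1 = eta 2 ^+ 2.
Proof.
rewrite jacobi_triple_product //.
have -> : eta 1 = qprod (-1) 4 1 * qprod (-1) 4 2 * qprod (-1) 4 3 * qprod (-1) 4 4.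
  by rewrite (eta_split 3) !big_ord_recr big_ord0 /= mul1r.
have e2 : eta 2 = qprod (-1) 4 2 * qprod (-1) 4 4.
  by rewrite (eta_split 1) !big_ord_recr big_ord0 /= mul1r.
have e2' : eta 2 = qprod (-1) 8 2 * qprod (-1) 8 4 * qprod (-1) 8 6 * qprod (-1) 8 8.
  by rewrite (eta_split 3) !big_ord_recr big_ord0 /= mul1r.
have e4 : qprod (-1) 4 4 = qprod (-1) 8 4 * qprod (-1) 8 8.
  by rewrite (qprod_split 1) // !big_ord_recr big_ord0 /= mul1r.
have c1 : qprod 1 4 1 * qprod (-1) 4 1 = qprod (-1) 8 2 by rewrite qprod_conj.
have c3 : qprod 1 4 3 * qprod (-1) 4 3 = qprod (-1) 8 6 by rewrite qprod_conj.
rewrite expr2 {1}e2 e2' -c1 -c3 e4; ring.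
Qed.

Lemma theta12_eta : theta 1 2 * (eta 1 * eta 6) = eta 2 * eta 3 ^+ 2.
Proof.
rewrite jacobi_triple_product //.
have -> : eta 1 = qprod (-1) 3 1 * qprod (-1) 3 2 * qprod (-1) 3 3.
  by rewrite (eta_split 2) !big_ord_recr big_ord0 /= mul1r.
have -> : eta 2 = qprod (-1) 6 2 * qprod (-1) 6 4 * qprod (-1) 6 6.
  by rewrite (eta_split 2) !big_ord_recr big_ord0 /= mul1r.
have -> : qprod (-1) 6 2 = qprod 1 3 1 * qprod (-1) 3 1 by rewrite qprod_conj.
have -> : qprod (-1) 6 4 = qprod 1 3 2 * qprod (-1) 3 2 by rewrite qprod_conj.
rewrite [eta 3]etaE [eta 6]etaE; ring.
Qed.

Lemma theta51_eta :
  theta 5 1 * (eta 1 * eta 4 * eta 6) = eta 2 ^+ 2 * eta 3 * eta 12.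
Proof.
rewrite jacobi_triple_product //.
have -> : eta 1 = qprod (-1) 6 1 * qprod (-1) 6 2 * qprod (-1) 6 3 * qprod (-1) 6 4 *
    qprod (-1) 6 5 * qprod (-1) 6 6.
  by rewrite (eta_split 5) !big_ord_recr big_ord0 /= mul1r.
have e2 : eta 2 = qprod (-1) 6 2 * qprod (-1) 6 4 * qprod (-1) 6 6.
  by rewrite (eta_split 2) !big_ord_recr big_ord0 /= mul1r.
have e2' : eta 2 = qprod (-1) 12 2 * qprod (-1) 12 4 * qprod (-1) 12 6 * qprod (-1) 12 8 *
    qprod (-1) 12 10 * qprod (-1) 12 12.
  by rewrite (eta_split 5) !big_ord_recr big_ord0 /= mul1r.
have -> : eta 3 = qprod (-1) 6 3 * qprod (-1) 6 6.
  by rewrite (eta_split 1) !big_ord_recr big_ord0 /= mul1r.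
have -> : eta 4 = qprod (-1) 12 4 * qprod (-1) 12 8 * qprod (-1) 12 12.
  by rewrite (eta_split 2) !big_ord_recr big_ord0 /= mul1r.
have -> : eta 6 = qprod (-1) 12 6 * qprod (-1) 12 12.
  by rewrite (eta_split 1) !big_ord_recr big_ord0 /= mul1r.
have c1 : qprod 1 6 1 * qprod (-1) 6 1 = qprod (-1) 12 2 by rewrite qprod_conj.
have c5 : qprod 1 6 5 * qprod (-1) 6 5 = qprod (-1) 12 10 by rewrite qprod_conj.
rewrite expr2 {1}e2 e2' -c1 -c5 [eta 12]etaE; ring.
Qed.

(** Only the factors with odd exponent change under [q := -q]. *)
Lemma fneg_eta1 : fneg (eta 1) * (eta 1 * eta 4) = eta 2 ^+ 3.
Proof.
have e1 : eta 1 = qprod (-1) 2 1 * qprod (-1) 2 2.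
  by rewrite (eta_split 1) !big_ord_recr big_ord0 /= mul1r.
have e2 : eta 2 = qprod (-1) 4 2 * qprod (-1) 4 4.
  by rewrite (eta_split 1) !big_ord_recr big_ord0 /= mul1r.
have c : qprod 1 2 1 * qprod (-1) 2 1 = qprod (-1) 4 2 by rewrite qprod_conj.
have n1 : fneg (-1) = -1 by rewrite rmorphN rmorph1.
have m1 : fneg (qprod (-1) 2 1) = qprod 1 2 1.
  by rewrite (@qprod_neg (-1) 1 1) // expr1 mulrNN mulr1.
have m2 : fneg (qprod (-1) 2 2) = qprod (-1) 2 2.
  by rewrite (@qprod_neg (-1) 1 2) // sqrrN expr1n mul1r.
have -> : eta 2 ^+ 3 = qprod (-1) 2 2 * qprod (-1) 2 2 * eta 2 by rewrite -[qprod _ 2 2]etaE; ring.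
rewrite e2 -c e1 rmorphM /= m1 m2 [eta 4]etaE; ring.
Qed.

Lemma fneg_eta3 : fneg (eta 3) * (eta 3 * eta 12) = eta 6 ^+ 3.
Proof.
have := congr1 (dil 3) fneg_eta1.
by rewrite rmorphXn !rmorphM /= -fneg_dil_odd // !dil_eta.
Qed.

Lemma fneg_eta_even k : ~~ odd k -> fneg (eta k) = eta k.
Proof. exact: fneg_dil. Qed.

Lemma eta_unit k : eta k \is a GRing.unit.
Proof. by rewrite funitE /eta coef_dil0 E_qprod /qprod /iprod big_ord0. Qed.

(** * The three eta quotients and their five relations *)

Definition etaT := fX * eta 12 ^+ 4 * eta 2 ^+ 2 / (eta 4 ^+ 4 * eta 6 ^+ 2).
Definition etaP := eta 3 ^+ 3 * eta 2 ^+ 2 * eta 12 / (eta 1 * eta 4 ^+ 3 * eta 6 ^+ 2).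
Definition etaQ := eta 2 ^+ 9 * eta 3 * eta 12 ^+ 2 / (eta 1 ^+ 3 * eta 4 ^+ 6 * eta 6 ^+ 3).

Lemma unit_div (R : comUnitRingType) (a b c : R) : b \is a GRing.unit -> a * b = c -> a = c / b.
Proof. by move=> ub <-; rewrite mulrK. Qed.

Ltac units := rewrite ?(unitrM, unitrV, unitrX, eta_unit, rmorph_unit) //.
Lemma fps_in_field : exists (K : fieldType) (v : {rmorphism fps -> K}),
  injective v /\ forall k, v (eta k) != 0.
Proof.
have [K [v iv]] := idomain_embeds_in_field fps; exists K, v; split=> // k.
by rewrite -unitfE rmorph_unit ?eta_unit.
Qed.
Ltac morph :=
  rewrite ?(rmorphXn, rmorphM, rmorphD, rmorphB, rmorphN, rmorph_nat, rmorph1, rmorphV) /=;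
  units.
(** In the field, the side conditions reduce to the nonvanishing of each [eta k]. *)
Ltac eta_field :=
  let K := fresh "K" in let v := fresh "v" in let iv := fresh "iv" in
  let nz := fresh "nz" in
  have [K [v [iv nz]]] := fps_in_field; refine (iv _ _ _); clear iv;
  morph; field; do ?[apply/andP; split]; exact: nz.

Lemma fneg_eta1E : fneg (eta 1) = eta 2 ^+ 3 / (eta 1 * eta 4).
Proof. by apply: unit_div fneg_eta1; units. Qed.
Lemma fneg_eta3E : fneg (eta 3) = eta 6 ^+ 3 / (eta 3 * eta 12).
Proof. by apply: unit_div fneg_eta3; units. Qed.

Definition fneg_etas := (fneg_eta1E, fneg_eta3E, @fneg_eta_even 2 isT,
  @fneg_eta_even 4 isT, @fneg_eta_even 6 isT, @fneg_eta_even 12 isT).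

Lemma fneg_etaT : fneg etaT = - etaT.
Proof.
rewrite /etaT; morph; rewrite !fneg_etas fneg_X; ring.
Qed.
Lemma fneg_etaP : fneg etaP =
  eta 6 ^+ 7 * eta 1 / (eta 3 ^+ 3 * eta 12 ^+ 2 * eta 2 * eta 4 ^+ 2).
Proof.
rewrite /etaP; morph.
rewrite !fneg_etas.
eta_field.
Qed.

Lemma fneg_etaQ : fneg etaQ = eta 1 ^+ 3 * eta 12 / (eta 3 * eta 4 ^+ 3).
Proof. rewrite /etaQ; morph. rewrite !fneg_etas. eta_field. Qed.

Lemma dil_etaE j k : dil j.+1 (eta k.+1) = eta (j.+1 * k.+1).
Proof. exact: dil_eta. Qed.

Lemma fX_dil2 : dil 2 fX = fX ^+ 2.
Proof. by rewrite -[fX]expr1 dilX. Qed.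

Ltac expand := rewrite ?(fneg_etaP, fneg_etaQ) /etaT /etaP /etaQ; morph; rewrite ?fX_dil2 ?dil_etaE /=; units.

(** Once [etaP] and [etaQ] are identified, this reads [t^2 (1 + 3T) = T (1 - T)] with [T = t(q^2)],
    a modular equation of degree 2. *)
Lemma etaT_sqr : etaT ^+ 2 * dil 2 etaQ = dil 2 etaT * dil 2 (fneg etaP).
Proof. expand. eta_field. Qed.

Lemma etaP_mul_fneg : etaP * fneg etaP * dil 2 etaQ = dil 2 etaP ^+ 2.
Proof. expand. eta_field. Qed.

Lemma etaQ_mul_fneg : etaQ * fneg etaQ * dil 2 etaQ = dil 2 (fneg etaQ) ^+ 2.
Proof. expand. eta_field. Qed.

Lemma theta11E : theta 1 1 = eta 2 ^+ 5 / (eta 1 ^+ 2 * eta 4 ^+ 2).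
Proof. by apply: unit_div theta11_eta; units. Qed.
Lemma theta31E : theta 3 1 = eta 2 ^+ 2 / eta 1.
Proof. by apply: unit_div theta31_eta; units. Qed.
Lemma theta12E : theta 1 2 = eta 2 * eta 3 ^+ 2 / (eta 1 * eta 6).
Proof. by apply: unit_div theta12_eta; units. Qed.
Lemma theta51E : theta 5 1 = eta 2 ^+ 2 * eta 3 * eta 12 / (eta 1 * eta 4 * eta 6).
Proof. by apply: unit_div theta51_eta; units. Qed.

Lemma etaP_sub_fneg : etaP - fneg etaP = 2 * etaT.
Proof.
apply/eqP; rewrite -subr_eq0; apply/eqP.
(* The prefactor carries the three theta terms to [etaP], [fneg etaP] and [2 * etaT]
   respectively. *)
transitivity (eta 1 * eta 12 / (eta 3 * eta 4 ^+ 3) * (theta 1 2 ^+ 2 -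
  (dil 2 (theta 1 2) * dil 3 (theta 1 1) + 2 * fX * theta 5 1 * dil 6 (theta 3 1)))).
  rewrite theta11E theta31E theta12E theta51E; expand.
  eta_field.
by rewrite theta12_sqr subrr mulr0.
Qed.

Lemma etaPQ_sub_fneg : fneg etaP * etaQ - etaP * fneg etaQ = 4 * etaT.
Proof.
apply/eqP; rewrite -subr_eq0; apply/eqP.
(* The prefactor is even in [q] and carries the first theta product to [fneg etaP * etaQ], hence the
   second to [etaP * fneg etaQ]. *)
transitivity (eta 2 ^+ 3 * eta 12 ^+ 2 / (eta 4 ^+ 6 * eta 6) *
  (theta 1 1 * dil 3 (theta 1 1) - fneg (theta 1 1 * dil 3 (theta 1 1)) -
   4 * fX * dil 2 (theta 3 1) * dil 6 (theta 3 1))).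
  rewrite theta11E theta31E; expand. rewrite !fneg_etas.
  eta_field.
by rewrite theta11_odd_part subrr mulr0.
Qed.

(** * The five relations determine the eta quotients *)

(** As a ring morphism, the constant term can be computed through quotients. *)
Definition ev0 (f : fps) : rat := f 0%N.
Fact ev0B : zmod_morphism ev0. Proof. by []. Qed.
Fact ev0M : monoid_morphism ev0. Proof. by split => // f g; apply: fcoefM0. Qed.
HB.instance Definition _ := GRing.isZmodMorphism.Build fps rat ev0 ev0B.
HB.instance Definition _ := GRing.isMonoidMorphism.Build fps rat ev0 ev0M.

Lemma ev0_eta k : ev0 (eta k) = 1.
Proof. by rewrite /ev0 /eta coef_dil0 E_qprod /qprod /iprod big_ord0. Qed.

Lemma etaP0 : etaP 0%N = 1.
Proof. by rewrite -[LHS]/(ev0 etaP) /etaP; morph; rewrite !ev0_eta !(expr1n, mul1r, mulr1, invr1). Qed.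

Lemma etaT0 : etaT 0%N = 0.
Proof. by rewrite -[LHS]/(ev0 etaT) /etaT; morph; rewrite /ev0 /fX !mul0r. Qed.

Lemma coefM_low k (a b : fps) : modX k a 0 -> (a * b) k.+1 = a k.+1 * b 0%N.
Proof.
move=> a0; rewrite fcoefM big_ord_recr /= subnn big1 ?add0r // => i _.
by rewrite a0 ?fcoef0 ?mul0r // -ltnS.
Qed.

(** The product of the deviations from [1] has no coefficient at [k + 1]. *)
Lemma coefM_flat k (a b : fps) : modX k a 1 -> modX k b 1 ->
  (a * b) k.+1 = a k.+1 + b k.+1.
Proof.
move=> a1 b1; have -> : a * b = a + b - 1 + (a - 1) * (b - 1) by ring.
have low : modX k (a - 1) 0 by rewrite -(subrr (1 : fps)); apply: modXB.
rewrite fcoefD coefM_low // [(b - 1) 0%N]fcoefB b1 // subrr mulr0 addr0.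
by rewrite fcoefB fcoefD fcoef1 subr0.
Qed.

Lemma modX1M k (a b : fps) : modX k a 1 -> modX k b 1 -> modX k (a * b) 1.
Proof. by move=> a1 b1; rewrite -[X in modX _ _ X](mulr1 1); apply: modXM. Qed.

(** Dilation doubles the order of the deviation from [1]; this gain drives the induction in
    [rigidity]. *)
Lemma modX1_dil2 k f : modX k f 1 -> modX k.+1 (dil 2 f) 1.
Proof.
move=> f1 i le_ik; rewrite /dil fcoef1; case: ifP => [/dvdnP[j ej]|nd].
  rewrite ej mulnK // f1 ?fcoef1; last by lia.
  by congr (_%:R); lia.
by case: eqP => // i0; rewrite i0 dvdn0 in nd.
Qed.

(** By induction [n] is [1] up to order [k], and [h] one order further. At [k + 1] the first
    relation then gives [2 (c + c') = 0] and the second [2 (c' - c) = 0], where [c] and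
    [c' = (-1)^(k+1) c] are the coefficients of [n] and [fneg n]. Parity decides which of them
    forces [c = 0]. *)
Lemma rigidity (n h t : fps) :
  n 0%N = 1 -> t 0%N = 0 -> h = dil 2 n ->
  n ^+ 2 * fneg n ^+ 2 * dil 2 h ^+ 2 = h ^+ 2 * dil 2 (fneg n) ^+ 4 ->
  (h - t) * h * (h + 3 * t) * fneg n ^+ 2 - (h + t) * h * (h - 3 * t) * n ^+ 2 =
    4 * t * n ^+ 2 * fneg n ^+ 2 ->
  n = 1.
Proof.
move=> n0 t0 eh ge go; apply/fpsP => k; move: k (leqnn k).
suff: forall k, modX k n 1 by move=> H k _; apply: H.
elim=> [|k IHk].
  by move=> i; rewrite leqn0 => /eqP ->; rewrite n0 fcoef1.
set m := fneg n in ge go.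
have mk : modX k m 1 by rewrite -(rmorph1 fneg); apply: modX_fneg.
have hk : modX k.+1 h 1 by rewrite eh; apply: modX1_dil2.
have hk' := modX_le (leqnSn k) hk.
have dhk : modX k.+1 (dil 2 h) 1 by apply: modX1_dil2.
have dmk : modX k.+1 (dil 2 m) 1 by apply: modX1_dil2.
have m2 : m k.+1 = (-1) ^+ k.+1 * n k.+1 by [].
have n2k : modX k (n ^+ 2) 1 by apply: modX1M.
have m2k : modX k (m ^+ 2) 1 by apply: modX1M.
have cn2 : (n ^+ 2) k.+1 = 2 * n k.+1 by rewrite expr2 coefM_flat //; ring.
have cm2 : (m ^+ 2) k.+1 = 2 * m k.+1 by rewrite expr2 coefM_flat //; ring.
suff c0 : n k.+1 = 0.
  move=> i; rewrite leq_eqVlt => /predU1P[->|]; first by rewrite c0 fcoef1.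
  exact: IHk.
have h2k : modX k.+1 (h ^+ 2) 1 by apply: modX1M.
case ok: (odd k.+1).
  (* On the right the bracket vanishes up to order [k] and [t] has no constant term, so coefficient
     [k + 1] is [0]. *)
  have W : (m ^+ 2 - n ^+ 2) * (h * (h ^+ 2 - 3 * t ^+ 2)) =
      (4 * n ^+ 2 * m ^+ 2 - 2 * h ^+ 2 * (m ^+ 2 + n ^+ 2)) * t.
    transitivity ((h - t) * h * (h + 3 * t) * m ^+ 2 -
      (h + t) * h * (h - 3 * t) * n ^+ 2 - 2 * h ^+ 2 * t * (m ^+ 2 + n ^+ 2)).
      by ring.
    by rewrite go; ring.
  have lowW : modX k (m ^+ 2 - n ^+ 2) 0.
    by rewrite -(subrr (1 : fps)); apply: modXB.
  have lowB : modX k (4 * n ^+ 2 * m ^+ 2 - 2 * h ^+ 2 * (m ^+ 2 + n ^+ 2)) 0.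
    have -> : (0 : fps) = 4 * 1 * 1 - 2 * 1 * (1 + 1) by ring.
    by apply: modXB; do ?[apply: modXM|apply: modXD] => //; apply: modX_le h2k.
  have /fpsP/(_ k.+1) := W; rewrite (coefM_low _ lowW) (coefM_low _ lowB) t0 mulr0.
  have -> : (h * (h ^+ 2 - 3 * t ^+ 2)) 0%N = 1.
    have ht : ev0 t = 0 by [].
    have hh : ev0 h = 1 by rewrite /ev0 hk.
    rewrite -[LHS]/(ev0 (h * (h ^+ 2 - 3 * t ^+ 2))) rmorphM rmorphB rmorphXn.
    by rewrite rmorphM rmorphXn /= ht hh; ring.
  by rewrite mulr1 fcoefB cn2 cm2 m2 -signr_odd ok expr1; lra.
have /fpsP/(_ k.+1) := ge.
have -> : dil 2 m ^+ 4 = dil 2 m ^+ 2 * dil 2 m ^+ 2 by rewrite -exprD.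
have low f : modX k.+1 f 1 -> f k.+1 = 0 by move=> ->; rewrite // fcoef1.
rewrite [RHS]low; last by do ?apply: modX1M.
rewrite (@coefM_flat k); first last.
- by apply: modX1M; apply: modX_le (leqnSn k) _.
- exact: modX1M.
rewrite coefM_flat // [(dil 2 h ^+ 2) _]low ?cn2 ?cm2; last exact: modX1M.
by rewrite m2 -signr_odd ok expr0; lra.
Qed.

(** With [p = h + t] and [h = dil 2 n], the product relations for [t] and [p] express [q] by [n] and
    [t]. Substitution into the other two relations yields the hypotheses of [rigidity]. *)
Lemma three_relations_determine (p q t : fps) :
  p 0%N = 1 -> t 0%N = 0 -> fneg t = - t ->
  t ^+ 2 * dil 2 q = dil 2 t * dil 2 (fneg p) ->
  p * fneg p * dil 2 q = dil 2 p ^+ 2 ->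
  q * fneg q * dil 2 q = dil 2 (fneg q) ^+ 2 ->
  p - fneg p = 2 * t -> fneg p * q - p * fneg q = 4 * t ->
  p = 1 + t /\ q = 1 + 3 * t.
Proof.
move=> p0 t0 ot ht hp hq hpt hpq.
have eP : fneg p = p - 2 * t by rewrite -hpt; ring.
have [h hP] : exists h, p = h + t by exists (p - t); ring.
have hP' : fneg p = h - t by rewrite eP hP; ring.
have fh : fneg h = h.
  have -> : h = p - t by rewrite hP; ring.
  by rewrite rmorphB /= eP ot; ring.
have [n eh] : exists n, h = dil 2 n by exists (U h); rewrite dil_U.
have h0 : h 0%N = 1 by rewrite -p0 hP fcoefD t0 addr0.
have n0 : n 0%N = 1 by rewrite -h0 eh coef_dil0.
have [m em] : exists m, m = fneg n by exists (fneg n).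
have tD := ht; rewrite hP' rmorphB /= in tD.
(* Adds [hp] and [ht], as [h^2 = p * fneg p + t^2]. *)
have hD : dil 2 q * h ^+ 2 = dil 2 h * (dil 2 h + 3 * dil 2 t).
  have := hp; rewrite hP' hP rmorphD /= => pD.
  transitivity ((h + t) * (h - t) * dil 2 q + t ^+ 2 * dil 2 q); first by ring.
  by rewrite pD tD; ring.
(* Every factor of [hD] is a series in [q^2], so [dil 2] can be stripped. *)
have qn : q * n ^+ 2 = h * (h + 3 * t).
  apply: (@dil_inj 1); rewrite !(rmorphXn, rmorphM, rmorphD, rmorph_nat) /= -eh.
  exact: hD.
have qm : fneg q * m ^+ 2 = h * (h - 3 * t).
  have := congr1 fneg qn.
  by rewrite !(rmorphXn, rmorphM, rmorphD, rmorph_nat) /= fh ot mulrN -em.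
have qmD : dil 2 (fneg q) * dil 2 m ^+ 2 = dil 2 h * (dil 2 h - 3 * dil 2 t).
  have := congr1 (dil 2) qm.
  by rewrite !(rmorphXn, rmorphM, rmorphB, rmorph_nat).
have nz : (dil 2 h - 3 * dil 2 t) ^+ 2 != 0.
  apply: expf_neq0; apply/eqP => /(congr1 ev0).
  rewrite rmorphB rmorphM rmorph_nat rmorph0 /= /ev0 !coef_dil0 h0 t0 mulr0 subr0.
  by move/eqP; rewrite oner_eq0.
have n1 : n = 1.
  apply: (rigidity n0 t0 eh); rewrite -em.
    (* The extra factor, of constant term [1], brings in [dil 2 (fneg q)] through [qmD], and so
       makes [hq] applicable. *)
    apply: (mulfI nz).
    transitivity (n ^+ 2 * m ^+ 2 * (dil 2 (fneg q) ^+ 2) * dil 2 m ^+ 4).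
      transitivity (n ^+ 2 * m ^+ 2 * (dil 2 h * (dil 2 h - 3 * dil 2 t)) ^+ 2); first by ring.
      by rewrite -qmD; ring.
    rewrite -hq.
    transitivity ((q * n ^+ 2) * (fneg q * m ^+ 2) * dil 2 q * dil 2 m ^+ 4); first by ring.
    rewrite qn qm.
    transitivity (h ^+ 2 * (dil 2 q * h ^+ 2 - 9 * (t ^+ 2 * dil 2 q)) * dil 2 m ^+ 4);
      first by ring.
    by rewrite hD tD; ring.
  transitivity ((h - t) * (h * (h + 3 * t)) * m ^+ 2 - (h + t) * (h * (h - 3 * t)) * n ^+ 2);
    first by ring.
  rewrite -qn -qm.
  transitivity (((h - t) * q - (h + t) * fneg q) * n ^+ 2 * m ^+ 2); first by ring.
  by rewrite -hP' -hP hpq.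
have h1 : h = 1 by rewrite eh n1 rmorph1.
split; first by rewrite hP h1.
by move: qn; rewrite n1 h1 expr1n mulr1 => ->; ring.
Qed.

Lemma etaP_and_etaQ : etaP = 1 + etaT /\ etaQ = 1 + 3 * etaT.
Proof.
apply: three_relations_determine.
- exact: etaP0.
- exact: etaT0.
- exact: fneg_etaT.
- exact: etaT_sqr.
- exact: etaP_mul_fneg.
- exact: etaQ_mul_fneg.
- exact: etaP_sub_fneg.
- exact: etaPQ_sub_fneg.
Qed.

(** * Rational parametrization and the evaluations of [U] *)

(** Turns a claim about [U] into an identity of series, as [f + fneg f] is twice the even part of
    [f]. *)
Lemma U_even_part (f a : fps) : f + fneg f = 2 * dil 2 a -> U f = a.
Proof.
move=> /fpsP fa; apply/fpsP => n; have := fa (2 * n)%N.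
have -> : 2 * dil 2 a = dil 2 a + dil 2 a by ring.
rewrite !fcoefD /fneg exprM sqrrN !expr1n mul1r /dil dvdn_mulr // mulKn // /U.
by move=> ?; lra.
Qed.

Lemma xiE : xi = eta 2 ^+ 5 * eta 6 / (eta 1 * eta 3 ^+ 5).
Proof.
rewrite /xi finvE; last first.
  have uE : E \is a GRing.unit by rewrite -(dil1 E) eta_unit.
  by rewrite -funitE !fmul_mulr !fexpE unitrM uE unitrX ?eta_unit.
by rewrite !fmul_mulr !fexpE /eta dil1.
Qed.

Lemma gamE : gam = eta 1 ^+ 5 * eta 2 ^+ 5 * eta 6 ^+ 5 / eta 3 ^+ 15.
Proof.
rewrite /gam finvE; last by rewrite -funitE !fexpE; units.
by rewrite !fmul_mulr !fexpE /eta dil1 !mulrA.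
Qed.

Lemma kappaE : kappa = dil 2 gam ^+ 2 / gam.
Proof.
rewrite /kappa finvE ?fexpE //.
by rewrite -funitE gamE; units.
Qed.

Lemma kappa_etaP : kappa * fneg etaP ^+ 5 = 1.
Proof. rewrite kappaE gamE; expand. eta_field. Qed.

Lemma xi_etaP : xi * etaP ^+ 2 = etaQ.
Proof. rewrite xiE; expand. eta_field. Qed.

Lemma xi_dil : dil 2 xi * (etaP * fneg etaP) = 1.
Proof. rewrite xiE; expand. eta_field. Qed.

Lemma fpolyE f cs :
  fpoly f cs = \sum_(ck <- cs) ck.1%:~R * f ^+ ck.2.
Proof.
have scaleE (c : int) g : fscale c%:~R g = c%:~R * g.
  rewrite mulrzl; apply/fpsP => n; rewrite /fscale mulrzl.
  have mulrnE k : (g *+ k) n = g n *+ k.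
    by elim: k => [|k IHk]; rewrite ?mulr0n ?fcoef0 // !mulrSr fcoefD IHk.
  by case: c => k; rewrite ?NegzE ?mulrNz ?fcoefN -!pmulrn mulrnE.
elim: cs => [|[c k] cs IHcs]; first by rewrite big_nil.
by rewrite big_cons -IHcs /= fexpE scaleE.
Qed.

Lemma rational_parametrization :
  exists (K : fieldType) (v : {rmorphism fps -> K}) (t : K),
    [/\ injective v, (1 + t != 0) && (1 - t != 0),
        v kappa = ((1 - t) ^+ 5)^-1 /\ v (fneg kappa) = ((1 + t) ^+ 5)^-1,
        v xi = (1 + 3 * t) / (1 + t) ^+ 2 /\
        v (fneg xi) = (1 - 3 * t) / (1 - t) ^+ 2
      & v (dil 2 xi) = ((1 + t) * (1 - t))^-1].
Proof.
have [eP eQ] := etaP_and_etaQ.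
have eP' : fneg etaP = 1 - etaT by rewrite eP rmorphD rmorph1 /= fneg_etaT.
have eQ' : fneg etaQ = 1 - 3 * etaT.
  by rewrite eQ rmorphD rmorph1 rmorphM rmorph_nat /= fneg_etaT mulrN.
have [K [v [iv _]]] := fps_in_field; exists K, v, (v etaT).
have k1 := kappa_etaP; have x1 := xi_etaP; have y1 := xi_dil; have ot := fneg_etaT.
rewrite eP' in k1; rewrite eQ eP in x1; rewrite eP' eP in y1.
move: (kappa) (xi) (etaT) k1 x1 y1 ot => k x t k1 x1 y1 ot {eP eQ eP' eQ'}.
have k2 : fneg k * (1 + t) ^+ 5 = 1.
  have := congr1 fneg k1.
  by rewrite rmorphM rmorphXn rmorphB !rmorph1 /= ot opprK.
have x2 : fneg x * (1 - t) ^+ 2 = 1 - 3 * t.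
  have := congr1 fneg x1.
  by rewrite !(rmorphXn, rmorphM, rmorph_nat, rmorph1, rmorphD) /= ot mulrN.
move: (fneg k) (fneg x) (dil 2 x) k2 x2 y1 => k' x' y k2 x2 y1 {ot}.
move/(congr1 v): k1; move/(congr1 v): k2; move/(congr1 v): x1; move/(congr1 v): x2.
move/(congr1 v): y1; rewrite !(rmorphXn, rmorphM, rmorphN, rmorph_nat, rmorph1, rmorphD).
move: (v t) (v k) (v k') (v x) (v x') (v y) => {}t {}k {}k' {}x {}x' {}y y1 x2 x1 k2 k1.
(* By [y1] this product has an inverse, namely [y]. *)
have nz : (1 + t) * (1 - t) != 0.
  by apply: contraTneq (oner_neq0 K) => z; rewrite -y1 z mulr0 eqxx.
have /andP[nz1 nz2] : (1 + t != 0) && (1 - t != 0) by rewrite -negb_or -mulf_eq0.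
split; rewrite ?nz1 ?nz2 //.
- by rewrite -(mulfK (expf_neq0 5 nz2) k) k1 -(mulfK (expf_neq0 5 nz1) k') k2 !mul1r.
- by rewrite -(mulfK (expf_neq0 2 nz1) x) x1 -(mulfK (expf_neq0 2 nz2) x') x2.
- by rewrite -(mulfK nz y) y1 mul1r.
Qed.

Theorem theorem2p3 :
  [/\ U kappa = fpoly xi [:: (5%:Z, 3%N); (-20, 4%N); (16%:Z, 5%N)],
      U xi = fpoly xi [:: (5%:Z, 1%N); (-4, 2%N)],
      U (fexp kappa 2) =
        fpoly xi [:: (-1, 5%N); (50%:Z, 6%N); (-400, 7%N); (1120%:Z, 8%N);
                     (-1280, 9%N); (512%:Z, 10%N)],
      U (fmul kappa xi) = fpoly xi [:: (3%:Z, 3%N); (-18, 4%N); (16%:Z, 5%N)]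
    & U (fexp xi 2) = fpoly xi [:: (-9, 1%N); (58%:Z, 2%N); (-80, 3%N); (32%:Z, 4%N)]].
Proof.
have [K [v [t [iv /andP[nz1 nz2] [k1 k2] [x1 x2] y1]]]] := rational_parametrization.
rewrite !fexpE fmul_mulr.
move: (kappa) (xi) k1 k2 x1 x2 y1 => k x k1 k2 x1 x2 y1.
(* Each claim [U f = P(xi)] becomes [f + fneg f = 2 P(dil 2 xi)], an identity of rational functions
   of [t]. *)
split; apply: U_even_part; apply: iv;
  rewrite fpolyE !big_cons big_nil /=;
  rewrite ?(rmorphXn, rmorphM, rmorph_int, rmorph_nat, rmorph0, rmorphD) /=;
  rewrite ?k1 ?k2 ?x1 ?x2 ?y1.
all: field.
all: by rewrite ?nz1 ?nz2.
Qed.
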